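(* Let $K$ be a field, let $\mathcal{O}$ be an order ideal in $\mathbb{T}^n$ which has a MaxDeg border, and let $C_0$ be the subtuple of $C$ consisting of all indeterminates of total arrow degree zero. Then the following claims hold. (a) We have $I(\mathbb{B}_{\mathcal{O}})\cap K[C_0]=\{0\}$. (b) The ring $K[C_0]$ is the homogeneous component of degree zero of the non-negatively graded $K$-algebra $B_{\mathcal{O}}=K[C]/I(\mathbb{B}_{\mathcal{O}})$.
   Context: $\mathbb{T}^n$ is the set of terms (power products) in $x_1,\dots,x_n$. An order ideal is a finite set $\mathcal{O}=\{t_1,\dots,t_\mu\}\subseteq\mathbb{T}^n$ ($\mu\ge1$) closed under taking divisors; its border is $\partial\mathcal{O}=(x_1\mathcal{O}\cup\dots\cup x_n\mathcal{O})\setminus\mathcal{O}=\{b_1,\dots,b_\nu\}$. $\mathcal{O}$ has a MaxDeg border if $\deg(b_j)\ge\deg(t_i)$ for all $i,j$. $C=(c_{ij})$ is a tuple of $\mu\nu$ indeterminates, $K[C]=K[c_{11},\dots,c_{\mu\nu}]$. The generic multiplication matrix $\mathcal{A}_r\in\mathrm{Mat}_\mu(K[C])$ ($r=1,\dots,n$) has $(i,j)$ entry $\delta_{im}$ if $x_rt_j=t_m\in\mathcal{O}$ and $c_{im}$ if $x_rt_j=b_m\in\partial\mathcal{O}$. $I(\mathbb{B}_{\mathcal{O}})\subseteq K[C]$ is the ideal generated by the entries of all commutators $\mathcal{A}_k\mathcal{A}_\ell-\mathcal{A}_\ell\mathcal{A}_k$. It is homogeneous with respect to the total arrow grading, i.e.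 the $\mathbb{Z}$-grading with $\deg_W(c_{ij})=\deg(b_j)-\deg(t_i)$; $B_{\mathcal{O}}$ carries the induced grading. *)

(* Defs.v *)
From HB Require Import structures.
From mathcomp Require Import all_boot all_order all_algebra.
From mathcomp Require Import generic_quotient ring_quotient.
From mathcomp Require Import boolp.
From mathcomp Require Export mpoly.

Set Implicit Arguments.
Unset Strict Implicit.
Unset Printing Implicit Defensive.

Import Order.TTheory GRing.Theory Num.Theory.
Local Open Scope ring_scope.
Local Open Scope quotient_scope.

Definition border n (O : seq 'X_{1..n}) : seq 'X_{1..n} :=
  [seq w <- [seq (U_(k) + u)%MM | k <- enum 'I_n, u <- O] | w \notin O].

(* An order ideal comes with arbitrary enumerations t_1, ..., t_mu of its terms
   and b_1, ..., b_nu of its border. *)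
Record orderIdeal (n mu nu : nat) := OrderIdeal {
  oterm : mu.-tuple 'X_{1..n};
  bterm : nu.-tuple 'X_{1..n};
  oterm_gt0 : (0 < mu)%N;
  oterm_uniq : uniq oterm;
  oterm_closed : forall u v : 'X_{1..n},
    v \in oterm -> (u <= v)%MM -> u \in oterm;
  bterm_uniq : uniq bterm;
  bterm_border : bterm =i border oterm
}.

Definition maxdeg_border n mu nu (O : orderIdeal n mu nu) : Prop :=
  forall (i : 'I_mu) (j : 'I_nu),
    (mdeg (tnth (oterm O) i) <= mdeg (tnth (bterm O) j))%N.

Section GeneratedIdeal.
Variables (R : comNzRingType) (I : finType) (f : I -> R).

Definition gen_ideal : {pred R} :=
  fun p => `[< exists g : I -> R, p = \sum_i g i * f i >].

Lemma gen_idealP p :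
  reflect (exists g : I -> R, p = \sum_i g i * f i) (p \in gen_ideal).
Proof. exact: asboolP. Qed.

Lemma gen_ideal_closed : 1 \notin gen_ideal -> idealr_closed gen_ideal.
Proof.
move=> not1; split=> //.
  apply/gen_idealP; exists (fun=> 0); rewrite big1 // => i _; exact: mul0r.
move=> a u v /gen_idealP[g ->] /gen_idealP[h ->]; apply/gen_idealP.
exists (fun i => a * g i + h i); rewrite mulr_sumr -big_split /=.
by apply: eq_bigr => i _; rewrite mulrDl mulrA.
Qed.

End GeneratedIdeal.

Section BorderBasisScheme.
Variables (K : fieldType) (n mu nu : nat) (O : orderIdeal n mu nu).

Local Notation KC := {mpoly K[mu * nu]}.
Local Notation t := (tnth (oterm O)).
Local Notation b := (tnth (bterm O)).

Definition indet (i : 'I_mu) (j : 'I_nu) : KC := 'X_(mxvec_index i j).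

(* The final 0 is never reached: x_r t_j lies in O or in its border. *)
Definition genmulmx (r : 'I_n) : 'M[KC]_mu :=
  \matrix_(i, j)
    let w := (U_(r) + t j)%MM in
    if [pick m | t m == w] is Some m then (i == m)%:R
    else if [pick m | b m == w] is Some m then indet i m
    else 0.

Definition commutator_entry (x : 'I_n * 'I_n * ('I_mu * 'I_mu)) : KC :=
  let: (k, l, (i, j)) := x in
  (genmulmx k *m genmulmx l - genmulmx l *m genmulmx k) i j.

Definition border_ideal : {pred KC} := gen_ideal commutator_entry.

Lemma genmulmx0E (r : 'I_n) i j :
  (genmulmx r i j).@[fun=> 0] = (t i == (U_(r) + t j)%MM)%:R.
Proof.
have injt : injective t by apply/tuple_uniqP/oterm_uniq.
rewrite mxE /=; case: (pickP (fun m => t m == _)) => [m /eqP <-|noO].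
  by rewrite (inj_eq injt) rmorph_nat.
rewrite noO; case: pickP => [m _|_]; last by rewrite rmorph0.
by rewrite mevalXU.
Qed.

Lemma genmulmx_mul0E (k l : 'I_n) i j :
  ((genmulmx k *m genmulmx l) i j).@[fun=> 0]
  = (t i == (U_(k) + (U_(l) + t j))%MM)%:R.
Proof.
have injt : injective t by apply/tuple_uniqP/oterm_uniq.
rewrite mxE rmorph_sum /=.
under eq_bigr do rewrite rmorphM /= !genmulmx0E.
have [e|ne] := eqVneq (t i) _; last first.
  rewrite big1 // => m _; case: (eqVneq (t m)) => [e|_]; last by rewrite mulr0.
  by rewrite e (negPf ne) mul0r.
have /tnthP[m em] : (U_(l) + t j)%MM \in oterm O.
  apply: (oterm_closed (mem_tnth i (oterm O))).
  by rewrite e lem_addl.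
rewrite (bigD1 m) //= e em !eqxx mulr1 big1 ?addr0 // => p pm.
by rewrite (inj_eq injt p m) (negPf pm) mulr0.
Qed.

Lemma border_ideal_proper : 1 \notin border_ideal.
Proof.
apply/negP => /gen_idealP[g /(congr1 (meval (fun=> 0)))].
rewrite rmorph1 rmorph_sum /= big1 => [/eqP|]; first by rewrite oner_eq0.
case=> [[k l] [i j]] _; rewrite rmorphM /= mxE [X in _ + X]mxE rmorphB /=.
by rewrite !genmulmx_mul0E !addmA [(U_(k) + _)%MM]addmC subrr mulr0.
Qed.

HB.instance Definition _ :=
  isIdealr.Build KC border_ideal (gen_ideal_closed border_ideal_proper).

Definition border_alg : Type := {ideal_quot border_ideal}.
HB.instance Definition _ := GRing.ComNzRing.on border_alg.

Definition to_border_alg : KC -> border_alg := \pi_{ideal_quot border_ideal}.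

Fact to_border_alg_is_zmod_morphism : zmod_morphism to_border_alg.
Proof. exact: raddfB. Qed.
HB.instance Definition _ := GRing.isZmodMorphism.Build KC border_alg
  to_border_alg to_border_alg_is_zmod_morphism.

Fact to_border_alg_is_monoid_morphism : monoid_morphism to_border_alg.
Proof. by split; [exact: rmorph1 | exact: rmorphM]. Qed.
HB.instance Definition _ := GRing.isMonoidMorphism.Build KC border_alg
  to_border_alg to_border_alg_is_monoid_morphism.

Definition border_alg_scale (a : K) (x : border_alg) : border_alg :=
  to_border_alg a%:MP * x.

Fact border_alg_scaleA a c x :
  border_alg_scale a (border_alg_scale c x) = border_alg_scale (a * c) x.
Proof. by rewrite /border_alg_scale mulrA mpolyCM rmorphM. Qed.
Fact border_alg_scale1 : left_id 1 border_alg_scale.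
Proof. by move=> x; rewrite /border_alg_scale mpolyC1 rmorph1 mul1r. Qed.
Fact border_alg_scaleDr : right_distributive border_alg_scale +%R.
Proof. by move=> a x y; exact: mulrDr. Qed.
Fact border_alg_scaleDl x : {morph border_alg_scale^~ x : a c / a + c}.
Proof. by move=> a c; rewrite /border_alg_scale mpolyCD rmorphD mulrDl. Qed.
HB.instance Definition _ := GRing.Zmodule_isLmodule.Build K border_alg
  border_alg_scaleA border_alg_scale1 border_alg_scaleDr border_alg_scaleDl.

Fact border_alg_scaleAl a (x y : border_alg) : a *: (x * y) = (a *: x) * y.
Proof. exact: mulrA. Qed.
HB.instance Definition _ :=
  GRing.Lmodule_isLalgebra.Build K border_alg border_alg_scaleAl.
HB.instance Definition _ := GRing.Lalgebra_isComAlgebra.Build K border_alg.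

Fact to_border_alg_is_scalable : scalable to_border_alg.
Proof. by move=> a p; rewrite -mul_mpolyC rmorphM. Qed.
HB.instance Definition _ := GRing.isScalable.Build K KC border_alg *:%R
  to_border_alg to_border_alg_is_scalable.

Definition arrow_deg (i : 'I_mu) (j : 'I_nu) : int :=
  (mdeg (b j))%:Z - (mdeg (t i))%:Z.

Definition arrow_mdeg (m : 'X_{1..mu * nu}) : int :=
  \sum_i \sum_j arrow_deg i j *+ m (mxvec_index i j).

Definition arrow_homog (d : int) : {pred KC} :=
  fun p => all (fun m => arrow_mdeg m == d) (msupp p).

Definition border_alg_comp (d : int) (x : border_alg) : Prop :=
  exists2 p : KC, p \in arrow_homog d & x = to_border_alg p.

Definition indet0 : {set 'I_(mu * nu)} :=
  [set mxvec_index i j | i in 'I_mu, j in 'I_nu & arrow_deg i j == 0].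

Definition poly_indet0 : {pred KC} :=
  fun p => all (fun m : 'X_{1..mu * nu} =>
    [forall k, (m k != 0%N) ==> (k \in indet0)]) (msupp p).

End BorderBasisScheme.

Arguments border_ideal K {n mu nu} O.
Arguments border_alg K {n mu nu} O.
Arguments to_border_alg K {n mu nu} O.
Arguments border_alg_comp K {n mu nu} O.
Arguments poly_indet0 K {n mu nu} O.

Record is_grading (K : fieldType) (A : algType K) (comp : int -> A -> Prop) :
    Prop := IsGrading {
  grading0 : forall d, comp d 0;
  gradingP : forall d (a : K) x y, comp d x -> comp d y -> comp d (a *: x + y);
  grading1 : comp 0 1;
  gradingM : forall d e x y, comp d x -> comp e y -> comp (d + e) (x * y);
  grading_span : forall x, exists (s : seq int) (y : int -> A),
    (forall d, comp d (y d)) /\ x = \sum_(d <- s) y d;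
  grading_direct : forall (s : seq int) (y : int -> A), uniq s ->
    (forall d, comp d (y d)) -> \sum_(d <- s) y d = 0 ->
    forall d, d \in s -> y d = 0
}.

Definition is_nonneg_grading (K : fieldType) (A : algType K)
    (comp : int -> A -> Prop) : Prop :=
  is_grading comp /\ forall d x, d < 0 -> comp d x -> x = 0.

(* Main.v *)
From HB Require Import structures.
Require Import Defs.
From mathcomp Require Import all_boot all_order all_algebra.
From mathcomp Require Import mpoly.
From mathcomp Require boolp.
From mathcomp Require Import zify.
From mathcomp Require Import generic_quotient ring_quotient.

Set Implicit Arguments.
Unset Strict Implicit.
Unset Printing Implicit Defensive.

Import Order.TTheory GRing.Theory Num.Theory.

Local Open Scope ring_scope.

(** The commutators are homogeneous for the total arrow grading, because the
    (i, j) entry of a generic multiplication matrix has arrow degree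
    deg t_j + 1 - deg t_i; hence the ideal is homogeneous and the quotient is
    graded ([border_alg_grading]).  A MaxDeg border makes all arrow degrees
    non-negative, so the grading is non-negative, and a monomial has degree
    zero exactly when all the indeterminates that occur in it do: the component
    of K[C] of degree zero is K[C_0] ([arrow_homog0E]).

    What remains is that I meets K[C_0] in zero.  Consider the K-algebra
    endomorphism of K[C] that fixes C_0 and sends all other indeterminates to
    zero.  It is the identity on K[C_0], so it suffices that it kills I, that
    is, that the specialized multiplication matrices commute
    ([retract_genmulmx_mul]).  These matrices describe multiplication of terms
    followed by the truncated normal form [trunc_nf], which is the identity on
    O, sends a border term b to the combination of the terms of O of the same
    degree as b with coefficients in C_0, and is zero on all other terms.
    Applying first x_l and then x_k to t_j gives the truncated normal form of
    x_k x_l t_j, which is symmetric in k and l.  This is clear if x_l t_j lies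
    in O.  If x_l t_j is a border term, the MaxDeg condition says that its
    degree is at least that of every term of O, so multiplying it, or any term
    of that same degree, by x_k leads to a degree that no term of O has, where
    the truncated normal form vanishes ([trunc_nf_high]). *)

(** * Homogeneous components with respect to an integer weight *)

Section WeightGrading.
Variables (n : nat) (R : comNzRingType) (wt : 'X_{1..n} -> int).
Hypothesis wtD : forall m1 m2, wt (m1 + m2)%MM = wt m1 + wt m2.

Implicit Types (p q f g : {mpoly R[n]}) (d e : int).

Definition whomog d : {pred {mpoly R[n]}} :=
  fun p => all (fun m => wt m == d) (msupp p).

Definition wcomp d p : {mpoly R[n]} :=
  \sum_(m <- msupp p | wt m == d) p@_m *: 'X_[m].

Lemma whomogP d p :
  reflect (forall m, p@_m != 0 -> wt m = d) (p \in whomog d).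
Proof.
apply: (iffP allP) => h m; first by rewrite -mcoeff_msupp => /h /eqP.
by rewrite mcoeff_msupp => /h ->.
Qed.

Lemma mcoeff_wcomp d p m : (wcomp d p)@_m = if wt m == d then p@_m else 0.
Proof.
rewrite /wcomp big_mkcond raddf_sum /=.
have [e|ne] := eqVneq (wt m) d.
  rewrite [in RHS](mpolyE p) raddf_sum /=; apply: eq_bigr => m' _.
  rewrite mcoeffZ mcoeffX; have [->|ne] := eqVneq m' m.
    by rewrite e eqxx mcoeffZ mcoeffX eqxx.
  rewrite mulr0; case: ifP => _; rewrite ?mcoeff0 //.
  by rewrite mcoeffZ mcoeffX (negPf ne) mulr0.
rewrite big1 // => m' _; case: eqP => [e|_]; last by rewrite mcoeff0.
rewrite mcoeffZ mcoeffX; have [E|_] := eqVneq m' m; last by rewrite mulr0.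
by rewrite -E e eqxx in ne.
Qed.

Lemma wcomp_is_zmod_morphism d : zmod_morphism (wcomp d).
Proof.
move=> p q; apply/mpolyP => m; rewrite mcoeffB !mcoeff_wcomp mcoeffB.
by case: eqP; rewrite ?subr0.
Qed.

HB.instance Definition _ d := GRing.isZmodMorphism.Build
  {mpoly R[n]} {mpoly R[n]} (wcomp d) (wcomp_is_zmod_morphism d).

Lemma wcomp_whomog d p : wcomp d p \in whomog d.
Proof.
apply/whomogP => m; rewrite mcoeff_wcomp.
by case: (wt m =P d) => // _; rewrite eqxx.
Qed.

Lemma wcomp_homogE d e p :
  p \in whomog e -> wcomp d p = if e == d then p else 0.
Proof.
move=> /whomogP hp; apply/mpolyP => m; rewrite mcoeff_wcomp.
rewrite [RHS](fun_if (mcoeff m)) mcoeff0.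
by have [->|/hp -> //] := eqVneq p@_m 0; rewrite !if_same.
Qed.

Lemma whomog0 d : 0 \in whomog d.
Proof. by apply/whomogP => m; rewrite mcoeff0 eqxx. Qed.

Lemma whomogL d a p q :
  p \in whomog d -> q \in whomog d -> a *: p + q \in whomog d.
Proof.
move=> /whomogP hp /whomogP hq; apply/whomogP => m.
rewrite mcoeffD mcoeffZ => nz.
have [p0|/hp //] := eqVneq p@_m 0; apply: hq.
by move: nz; rewrite p0 mulr0 add0r.
Qed.

Lemma whomogB d p q :
  p \in whomog d -> q \in whomog d -> p - q \in whomog d.
Proof. by move=> hp hq; rewrite addrC -scaleN1r whomogL. Qed.

Lemma whomogX m : 'X_[m] \in whomog (wt m).
Proof.
apply/whomogP => m'; rewrite mcoeffX.
by case: (m =P m') => [->|_] //; rewrite eqxx.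
Qed.

Lemma whomog1 : 1 \in whomog 0.
Proof.
have w0 : wt 0%MM = 0 by apply: (addrI (wt 0%MM)); rewrite -wtD addm0 addr0.
by rewrite -w0 -mpolyX0 whomogX.
Qed.

Lemma whomogM d e p q :
  p \in whomog d -> q \in whomog e -> p * q \in whomog (d + e).
Proof.
move=> /allP hp /allP hq; apply/allP => m /msuppM_le/allpairsP[[m1 m2] /=].
by case=> /hp/eqP <- /hq/eqP <- ->; rewrite wtD.
Qed.

Lemma whomog_sum d (I : Type) (r : seq I) (F : I -> {mpoly R[n]}) :
  (forall i, F i \in whomog d) -> \sum_(i <- r) F i \in whomog d.
Proof.
move=> hF; elim/big_ind: _ => [|p q hp hq|//]; first exact: whomog0.
by rewrite -[p]scale1r whomogL.
Qed.

Lemma sum_wcomp p :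
  p = \sum_(d <- undup [seq wt m | m <- msupp p]) wcomp d p.
Proof.
apply/mpolyP => m; rewrite raddf_sum /=.
under eq_bigr do rewrite mcoeff_wcomp.
have [p0|nz] := eqVneq p@_m 0.
  by rewrite big1 // => d _; rewrite p0 if_same.
rewrite (bigD1_seq (wt m)) ?undup_uniq ?mem_undup ?map_f ?mcoeff_msupp //=.
by rewrite eqxx big1 ?addr0 // => d; rewrite eq_sym => /negPf ->.
Qed.

(** By linearity in [g] it is enough to look at a monomial [g], for which
    [g * f] is itself homogeneous. *)
Lemma wcompM d e g f :
  f \in whomog e -> wcomp d (g * f) = wcomp (d - e) g * f.
Proof.
move=> hf; rewrite [in LHS](mpolyE g) mulr_suml raddf_sum /=.
rewrite [in RHS]/wcomp mulr_suml [RHS]big_mkcond /=; apply: eq_bigr => m _.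
rewrite (@wcomp_homogE _ (wt m + e)); last first.
  by rewrite whomogM // -[X in X \in _]addr0 whomogL ?whomogX ?whomog0.
by rewrite -[X in _ = if X then _ else _](inj_eq (addIr e)) subrK.
Qed.

(** Multiplication by the homogeneous [f i] shifts degrees by [e i], so a
    component of a combination of the generators is the combination of the
    generators with the correspondingly shifted components of the coefficients. *)
Lemma wcomp_gen_ideal (I : finType) (f : I -> {mpoly R[n]}) (e : I -> int) d p :
  (forall i, f i \in whomog (e i)) ->
  p \in gen_ideal f -> wcomp d p \in gen_ideal f.
Proof.
move=> hf /gen_idealP[g ->]; apply/gen_idealP.
exists (fun i => wcomp (d - e i) (g i)); rewrite raddf_sum /=.
by apply: eq_bigr => i _; exact: wcompM.
Qed.

End WeightGrading.

(** * The total arrow grading of the border basis scheme *)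

Section BorderBasisScheme.
Variables (K : fieldType) (n mu nu : nat) (O : orderIdeal n mu nu).

Local Notation KC := {mpoly K[mu * nu]}.
Local Notation t := (tnth (oterm O)).
Local Notation b := (tnth (bterm O)).
Local Notation ad := (arrow_deg O).
Local Notation A := (genmulmx K O).

Lemma mxvec_index_inj (i i' : 'I_mu) (j j' : 'I_nu) :
  (mxvec_index i j == mxvec_index i' j') = (i == i') && (j == j').
Proof.
rewrite /mxvec_index (inj_eq (@cast_ord_inj _ _ _)) (inj_eq enum_rank_inj).
by rewrite xpair_eqE.
Qed.

Lemma arrow_mdegD m1 m2 :
  arrow_mdeg O (m1 + m2)%MM = arrow_mdeg O m1 + arrow_mdeg O m2.
Proof.
rewrite /arrow_mdeg -big_split; apply: eq_bigr => i _.
by rewrite -big_split; apply: eq_bigr => j _; rewrite mnmDE mulrnDr.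
Qed.

Lemma arrow_mdegU i j : arrow_mdeg O U_(mxvec_index i j) = ad i j.
Proof.
rewrite /arrow_mdeg pair_bigA (bigD1 (i, j)) //= mnm1E eqxx big1 ?addr0 //.
case=> i' j' /= ne; rewrite mnm1E mxvec_index_inj eq_sym [j == _]eq_sym.
by rewrite -xpair_eqE (negPf ne).
Qed.

Lemma border_step r j :
  (exists p, (U_(r) + t j)%MM = t p) \/ (exists q, (U_(r) + t j)%MM = b q).
Proof.
have [/tnthP|nO] := boolP ((U_(r) + t j)%MM \in oterm O); first by left.
right; apply/tnthP; rewrite bterm_border mem_filter nO /=.
by apply: allpairs_f; rewrite ?mem_enum ?mem_tnth.
Qed.

Lemma oterm_inj : injective t.
Proof. exact/tuple_uniqP/oterm_uniq. Qed.

Lemma bterm_inj : injective b.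
Proof. exact/tuple_uniqP/bterm_uniq. Qed.

Lemma oterm_neq_bterm p q : t p != b q.
Proof.
apply: contraL (mem_tnth p (oterm O)) => /eqP ->.
by have := mem_tnth q (bterm O); rewrite bterm_border mem_filter => /andP[].
Qed.

Lemma genmulmx_oterm r i j p :
  (U_(r) + t j)%MM = t p -> A r i j = (i == p)%:R.
Proof.
move=> e; rewrite mxE /= e; case: pickP => [m /eqP/oterm_inj -> //|/(_ p)].
by rewrite eqxx.
Qed.

Lemma genmulmx_bterm r i j q :
  (U_(r) + t j)%MM = b q -> A r i j = indet K i q.
Proof.
move=> e; rewrite mxE /= e; case: pickP => [m|_].
  by rewrite (negPf (oterm_neq_bterm _ _)).
by case: pickP => [m /eqP/bterm_inj -> //|/(_ q)]; rewrite eqxx.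
Qed.

(** If [x_r t_j] is the term [t_p] of O, the entry is a constant that can only be
    nonzero for [i = p], where the degree in question is zero; if it is the
    border term [b_q], the entry is the indeterminate [c_iq]. *)
Lemma genmulmx_homog r i j :
  A r i j \in arrow_homog O ((mdeg (t j)).+1%:Z - (mdeg (t i))%:Z).
Proof.
have dg : mdeg (U_(r) + t j) = (mdeg (t j)).+1 by rewrite mdegD mdeg1.
rewrite -dg.
case: (border_step r j) => [[p e]|[q e]]; last first.
  rewrite (genmulmx_bterm _ e) e -[_ - _]/(ad i q) -arrow_mdegU.
  exact: whomogX.
rewrite (genmulmx_oterm _ e) e.
have [->|_] := eqVneq i p; first by rewrite subrr; apply: whomog1 arrow_mdegD.
exact: whomog0.
Qed.

Lemma genmulmx_mul_homog k l i j :
  (A k *m A l) i j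
  \in arrow_homog O ((mdeg (t j)).+2%:Z - (mdeg (t i))%:Z).
Proof.
rewrite mxE; apply: whomog_sum => m.
have := whomogM arrow_mdegD (genmulmx_homog k i m) (genmulmx_homog l m j).
by congr (_ \in whomog _ _); lia.
Qed.

Lemma border_ideal_wcomp d p :
  p \in border_ideal K O -> wcomp (arrow_mdeg O) d p \in border_ideal K O.
Proof.
apply: (@wcomp_gen_ideal _ _ _ arrow_mdegD _ _ (fun x =>
  (mdeg (t x.2.2)).+2%:Z - (mdeg (t x.2.1))%:Z)).
case=> [[k l] [i j]]; rewrite /= mxE [X in _ + X]mxE.
by apply: whomogB; apply: genmulmx_mul_homog.
Qed.

Lemma to_border_alg_eq0 p :
  (to_border_alg K O p == 0) = (p \in border_ideal K O).
Proof.
rewrite -[p in RHS]subr0 Quotient.idealrBE -(rmorph0 (to_border_alg K O)).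
by [].
Qed.

Lemma border_alg_grading : is_grading (border_alg_comp K O).
Proof.
split=> [d|d a _ _ [p hp ->] [q hq ->]|||x|s y us hy].
- by exists 0; [exact: whomog0 | rewrite rmorph0].
- by exists (a *: p + q); [exact: whomogL | rewrite linearP].
- by exists 1; [exact: whomog1 arrow_mdegD | rewrite rmorph1].
- move=> d e _ _ [p hp ->] [q hq ->].
  by exists (p * q); [exact: (whomogM arrow_mdegD hp hq) | rewrite rmorphM].
- have [p ->] : exists p, x = to_border_alg K O p.
    by exists (repr x); rewrite /to_border_alg reprK.
  exists (undup [seq arrow_mdeg O m | m <- msupp p]).
  exists (fun d => to_border_alg K O (wcomp (arrow_mdeg O) d p)); split.
    by move=> d; exists (wcomp (arrow_mdeg O) d p); first exact: wcomp_whomog.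
  by rewrite {1}(sum_wcomp (arrow_mdeg O) p) raddf_sum.
(* Lift the summands to homogeneous polynomials; their sum lies in the
   homogeneous ideal, hence so does each of them. *)
have /boolp.choice[P hP] d : exists p,
    p \in arrow_homog O d /\ y d = to_border_alg K O p.
  by have [p] := hy d; exists p.
under eq_bigr do rewrite (hP _).2.
rewrite -rmorph_sum => /eqP; rewrite to_border_alg_eq0 => hI d ds.
rewrite (hP d).2; apply/eqP; rewrite to_border_alg_eq0.
suff -> : P d = wcomp (arrow_mdeg O) d (\sum_(e <- s) P e).
  exact: border_ideal_wcomp.
rewrite raddf_sum /= (bigD1_seq d) //= big1 => [|e /negPf ne].
  by rewrite (wcomp_homogE _ (hP d).1) eqxx addr0.
by rewrite (wcomp_homogE _ (hP e).1) ne.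
Qed.

(** * The degree-zero part under a MaxDeg border *)

Lemma indet0E i j : (mxvec_index i j \in indet0 O) = (ad i j == 0).
Proof.
apply/imset2P/eqP => [[i' j' _]|ad0]; last by exists i j; rewrite // inE ad0 /=.
rewrite inE /= => /eqP ad0 /eqP; rewrite mxvec_index_inj.
by case/andP=> /eqP -> /eqP ->.
Qed.

Section MaxDegBorder.
Hypothesis hO : maxdeg_border O.

Lemma arrow_deg_ge0 i j : 0 <= ad i j.
Proof. by rewrite subr_ge0 lez_nat hO. Qed.

Lemma arrow_mdeg_ge0 m : 0 <= arrow_mdeg O m.
Proof.
apply: sumr_ge0 => i _; apply: sumr_ge0 => j _.
by rewrite mulrn_wge0 ?arrow_deg_ge0.
Qed.

(** Arrow degrees are non-negative here, so no cancellation can occur between the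
    contributions of different indeterminates. *)
Lemma arrow_mdeg_eq0 (m : 'X_{1..mu * nu}) :
  (arrow_mdeg O m == 0) = [forall k, (m k != 0%N) ==> (k \in indet0 O)].
Proof.
have ge0 x : 0 <= ad x.1 x.2 *+ m (mxvec_index x.1 x.2).
  by rewrite mulrn_wge0 ?arrow_deg_ge0.
rewrite /arrow_mdeg pair_bigA psumr_eq0 //=.
apply/allP/forallP => [h k|h [i j] _] /=.
  case/mxvec_indexP: k => i j; have /= := h (i, j) (mem_index_enum _).
  by rewrite mulrn_eq0 indet0E -implyNb.
by rewrite mulrn_eq0 -implyNb -indet0E h.
Qed.

Lemma arrow_homog0E : arrow_homog O 0 =i poly_indet0 K O.
Proof. by move=> p; apply: eq_all => m; exact: arrow_mdeg_eq0. Qed.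

Definition degree0_indet (k : 'I_(mu * nu)) : KC :=
  if k \in indet0 O then 'X_k else 0.

Definition degree0_retract : KC -> KC := mmap (@mpolyC _ K) degree0_indet.

HB.instance Definition _ := GRing.RMorphism.on degree0_retract.

Lemma degree0_retract_id p : p \in poly_indet0 K O -> degree0_retract p = p.
Proof.
move=> /allP hp; rewrite [RHS]mpolyE; apply: eq_big_seq => m /hp /forallP hm.
rewrite mul_mpolyC -mmap1_id; congr (_ *: _); apply: eq_bigr => k _.
rewrite /degree0_indet; have := hm k.
by case: (m k) => [|e] /=; rewrite ?expr0 // => ->.
Qed.

(** Coordinates of the normal form of a term with respect to the generic border
    prebasis, after all indeterminates of nonzero arrow degree are set to zero.
    On terms outside O and its border the value zero is the correct one for the
    associativity in [retract_genmulmx_mul], since such terms only appear there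
    in degrees above those of O. *)
Definition trunc_nf (w : 'X_{1..n}) (i : 'I_mu) : KC :=
  if [pick m | t m == w] is Some m then (i == m)%:R
  else if [pick m | b m == w] is Some m then
    degree0_indet (mxvec_index i m)
  else 0.

Lemma retract_genmulmx r i j :
  degree0_retract (A r i j) = trunc_nf (U_(r) + t j)%MM i.
Proof.
rewrite mxE /= /trunc_nf; case: pickP => [m _|_]; first by rewrite rmorph_nat.
case: pickP => [m _|_]; last by rewrite rmorph0.
by rewrite /degree0_retract mmapX mmap1U.
Qed.

Lemma trunc_nf_oterm p i : trunc_nf (t p) i = (i == p)%:R.
Proof.
rewrite /trunc_nf; case: pickP => [m /eqP/oterm_inj -> //|/(_ p)].
by rewrite eqxx.
Qed.

Lemma trunc_nf_bterm q i :
  trunc_nf (b q) i = degree0_indet (mxvec_index i q).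
Proof.
rewrite /trunc_nf; case: pickP => [m|_].
  by rewrite (negPf (oterm_neq_bterm _ _)).
by case: pickP => [m /eqP/bterm_inj -> //|/(_ q)]; rewrite eqxx.
Qed.

(** Only the terms of O that have the degree of a border term contribute to its
    truncated normal form, and here there are none. *)
Lemma trunc_nf_high w i :
  (forall p, (mdeg (t p) < mdeg w)%N) -> trunc_nf w i = 0.
Proof.
move=> hw; rewrite /trunc_nf; case: pickP => [m /eqP e|_].
  by have := hw m; rewrite e ltnn.
case: pickP => [m /eqP e|//]; rewrite /degree0_indet indet0E /arrow_deg e.
by rewrite subr_eq0 eqz_nat gtn_eqF.
Qed.

(** The right-hand side depends only on the product of the two indeterminates, so
    this contains the commutation of the specialized matrices. *)
Lemma retract_genmulmx_mul k l i j :
  degree0_retract ((A k *m A l) i j) = trunc_nf (U_(k) + (U_(l) + t j))%MM i.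
Proof.
rewrite mxE rmorph_sum.
under eq_bigr do rewrite rmorphM /= !retract_genmulmx.
case: (border_step l j) => [[p ->]|[q ->]].
  rewrite (bigD1 p) //= trunc_nf_oterm eqxx mulr1 big1 ?addr0 // => m /negPf ne.
  by rewrite trunc_nf_oterm ne mulr0.
(* By the MaxDeg condition, terms of degree [deg b_q] leave the degree range of
   O when multiplied by [x_k]; both sides then vanish. *)
have high w p : mdeg w = mdeg (b q) -> (mdeg (t p) < mdeg (U_(k) + w))%N.
  by move=> e; rewrite mdegD mdeg1 e ltnS hO.
rewrite [RHS]trunc_nf_high; last by move=> p; apply: high.
rewrite big1 // => m _; rewrite trunc_nf_bterm /degree0_indet indet0E.
case: eqP => [/eqP|_]; last by rewrite mulr0.
rewrite subr_eq0 eqz_nat => /eqP e.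
by rewrite trunc_nf_high ?mul0r // => p; apply: high.
Qed.

Lemma degree0_retract_ideal p :
  p \in border_ideal K O -> degree0_retract p = 0.
Proof.
move=> /gen_idealP[g ->]; rewrite rmorph_sum big1 //= => -[[k l] [i j]] _.
rewrite rmorphM /= mxE [X in _ + X]mxE rmorphB /= !retract_genmulmx_mul.
by rewrite !addmA [(U_(k) + _)%MM]addmC subrr mulr0.
Qed.

Lemma border_ideal_poly_indet0 p :
  p \in border_ideal K O -> p \in poly_indet0 K O -> p = 0.
Proof. by move=> /degree0_retract_ideal + /degree0_retract_id => ->. Qed.

End MaxDegBorder.
End BorderBasisScheme.

Theorem proposition3p4 (K : fieldType) (n mu nu : nat)
    (O : orderIdeal n mu nu) (hO : maxdeg_border O) :
  (forall p : {mpoly K[mu * nu]},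
      (p \in border_ideal K O /\ p \in poly_indet0 K O) <-> p = 0)
  /\
  (is_nonneg_grading (border_alg_comp K O)
   /\ {in poly_indet0 K O &, injective (to_border_alg K O)}
   /\ forall x : border_alg K O,
        border_alg_comp K O 0 x
        <-> exists2 p, p \in poly_indet0 K O & x = to_border_alg K O p).
Proof.
have indet0_0 : 0 \in poly_indet0 K O by rewrite -arrow_homog0E ?whomog0.
split=> [p|]; first split=> [[]|->].
- exact: border_ideal_poly_indet0.
- by split; [exact: idealr0 | exact: indet0_0].
split; [split|split].
- exact: border_alg_grading.
- move=> d _ d0 [p /allP hp ->].
  suff /msuppnil0 -> : msupp p = [::] by rewrite rmorph0.
  case: (msupp p) hp => // m s /(_ m (mem_head _ _)) /eqP e.
  by have := arrow_mdeg_ge0 hO m; rewrite e leNgt d0.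
- move=> p q hp hq e; apply/eqP; rewrite -subr_eq0; apply/eqP.
  apply: (border_ideal_poly_indet0 hO).
    by rewrite -to_border_alg_eq0 rmorphB /= e subrr.
  by move: hp hq; rewrite -!(arrow_homog0E hO); exact: whomogB.
- by move=> x; split=> -[p hp ->]; exists p => //; move: hp;
    rewrite arrow_homog0E.
Qed.
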